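(* Let $-\infty\le a<b\le\infty$, let $X$ be a one-dimensional (real-valued) random variable with finite mean $\mu=E[X]$ and $P(X\in(a,b))=1$, and let $\varphi:(a,b)\to\mathbb{R}$ be twice differentiable on $(a,b)$. Assume that $E[\varphi(X)]$ exists (as an extended real number). Then $$\inf_{x\in(a,b)}\{h(x;\mu)\}\,\mathrm{var}(X)\;\le\; E[\varphi(X)]-\varphi(E[X])\;\le\;\sup_{x\in(a,b)}\{h(x;\mu)\}\,\mathrm{var}(X).$$
   Context: For $\nu\in(a,b)$ and $x\in(a,b)$ with $x\neq\nu$, define $$h(x;\nu)=\frac{\varphi(x)-\varphi(\nu)}{(x-\nu)^2}-\frac{\varphi'(\nu)}{x-\nu},$$ and set $h(\nu;\nu)=\varphi''(\nu)/2$, which is $\lim_{x\to\nu}h(x;\nu)$. Note that $\mu\in(a,b)$ because $P(X\in(a,b))=1$. The infimum and supremum are taken in the extended reals $[-\infty,\infty]$, $\mathrm{var}(X)\in[0,\infty]$, inequalities are in the extended reals, and $0\cdot(\pm\infty)=0$. *)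

(* Defs.v *)
From mathcomp Require Import all_boot all_order all_algebra.
From mathcomp Require Import all_classical all_reals all_analysis.

Set Implicit Arguments.
Unset Strict Implicit.
Unset Printing Implicit Defensive.

Import Order.TTheory GRing.Theory Num.Theory.
Import numFieldNormedType.Exports.

Local Open Scope classical_set_scope.
Local Open Scope ring_scope.

Definition open_itv (R : realType) (a b : \bar R) : set R :=
  [set x | (a < x%:E)%E /\ (x%:E < b)%E].

(* A function (a, b) -> R is represented by phi : R -> R whose values outside
   (a, b) are never used. As (a, b) is open, the derivatives at its points
   depend only on phi restricted to (a, b). *)
Definition twice_derivable_on (R : realType) (D : set R) (phi : R -> R) : Prop :=
  forall x, D x -> derivable phi x 1 /\ derivable phi^`()%classic x 1.

Definition h (R : realType) (phi : R -> R) (x nu : R) : R :=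
  if x == nu then phi^`(2)%classic nu / 2
  else (phi x - phi nu) / (x - nu) ^+ 2 - phi^`()%classic nu / (x - nu).

(* phi(X) when X lies almost surely in D: values of phi outside D, where it is
   junk and possibly not measurable, are replaced by 0. *)
Definition comp_on (R : realType) (T : Type) (D : set R) (phi : R -> R)
    (X : T -> R) : T -> R :=
  (phi \_ D) \o X.

(* 'E_P[Y] is always defined in the library (with +oo - oo = -oo); it is the
   expectation of Y only when one of the two parts has finite expectation. *)
Definition expectation_exists d (T : measurableType d) (R : realType)
    (P : probability T R) (Y : T -> R) : Prop :=
  ('E_P[Y^\+] < +oo \/ 'E_P[Y^\-] < +oo)%E.

(* Main.v *)
(* By definition of [h], phi x = phi mu + phi'(mu) (x - mu) + h(x; mu) (x - mu)^2
   on (a, b). With s the supremum of [h], integrating phi(X) <= phi mu +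
   phi'(mu) (X - mu) + s (X - mu)^2 gives the upper bound when s is finite; if
   var X = +oo and s < 0, then E[phi X] = -oo, since otherwise (X - mu)^2 would
   be integrable; if s = +oo, only var X = 0 is not trivial, and then X = mu
   almost surely. The lower bound is the upper bound for -phi; this is where
   the existence of E[phi X] matters, for E[- phi X] = - E[phi X]. *)
Require Import Defs.
From mathcomp Require Import all_boot all_order all_algebra.
From mathcomp Require Import all_classical all_reals all_analysis.
From mathcomp Require Import measurable_realfun ring.

Import Order.TTheory GRing.Theory Num.Theory.
Import numFieldNormedType.Exports.

Local Open Scope classical_set_scope.
Local Open Scope ring_scope.

Section integral.
Context d (T : measurableType d) (R : realType) (m : {measure set T -> \bar R}).
Implicit Types (Y Z W : T -> R) (r : R).
Local Open Scope ereal_scope.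

(** The positive parts are ordered like [f] and [g], the negative parts the other way, and extended
    subtraction respects both orders even when it meets +oo - oo = -oo. *)
Lemma ae_le_integral (D : set T) (f g : T -> \bar R) : measurable D ->
  measurable_fun D f -> measurable_fun D g ->
  {ae m, forall x, D x -> f x <= g x} ->
  \int[m]_(x in D) f x <= \int[m]_(x in D) g x.
Proof.
move=> mD mf mg fg; rewrite integralE [leRHS]integralE leeB//.
- apply: ae_ge0_le_integral => //; [exact: measurable_funepos..|].
  apply: filterS fg => x + Dx => /(_ Dx) fg.
  by rewrite !funeposE ge_max !le_max fg lexx orbT.
- apply: ae_ge0_le_integral => //; [exact: measurable_funeneg..|].
  apply: filterS fg => x + Dx => /(_ Dx) fg.
  by rewrite !funenegE ge_max !le_max leeN2 fg lexx orbT.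
Qed.

Lemma le_integral_affine Y Z W r : measurable_fun setT Y ->
  m.-integrable setT (EFin \o Z) -> measurable_fun setT W ->
  (forall x, (0 <= W x)%R) ->
  {ae m, forall x, (Y x <= Z x + r * W x)%R} ->
  \int[m]_x (Y x)%:E <= \int[m]_x (Z x)%:E + r%:E * \int[m]_x (W x)%:E.
Proof.
move=> mY iZ mW W0 YZW.
have mZ : measurable_fun setT Z by apply/measurable_EFinP/(measurable_int m).
have mE f : measurable_fun setT f -> measurable_fun setT (EFin \o f : T -> \bar R).
  by move=> ?; exact/measurable_EFinP.
have Zfin : \int[m]_x (Z x)%:E \is a fin_num by exact: integrable_fin_num iZ.
have [Wfin|] := boolP (\int[m]_x (W x)%:E \is a fin_num).
  have iW : m.-integrable setT (EFin \o W).
    apply/integrableP; split; first exact: mE.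
    by rewrite integral_fin_num_abs.
  have irW := integrableZl measurableT r iW.
  rewrite -integralZl// -integralD//.
  apply: ae_le_integral => //; first exact: mE.
    exact: (measurable_int m (integrableD measurableT iZ irW)).
  by apply: filterS YZW => x YZ _; rewrite -EFinM -EFinD lee_fin.
rewrite ge0_fin_numE ?integral_ge0// => [|x _]; last by rewrite lee_fin.
rewrite -leNgt leye_eq => /eqP Woo; rewrite Woo.
have YZ : (r <= 0)%R -> \int[m]_x (Y x)%:E <= \int[m]_x (Z x)%:E.
  move=> r0; apply: ae_le_integral => //; [exact: mE..|].
  apply: filterS YZW => x /le_trans YZ _; rewrite lee_fin YZ//.
  by rewrite gerDl mulr_le0_ge0.
have [r0|r0|r0] := ltgtP r 0%R; first last.
- by rewrite r0 mul0e adde0 YZ ?r0.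
- rewrite gt0_muley ?lte_fin// addey ?leey//.
  by move: Zfin; rewrite fin_numE => /andP[].
rewrite lt0_muley ?lte_fin// addeNy.
rewrite leNgt; apply/negP => Yoo.
(* [Y] would be integrable, hence also [W], which is at most [(Y - Z) / r] *)
have Yfin : \int[m]_x (Y x)%:E \is a fin_num.
  rewrite fin_numElt Yoo/= (le_lt_trans (YZ (ltW r0)))//.
  by rewrite ltey_eq Zfin.
have iY : m.-integrable setT (EFin \o Y).
  apply/integrableP; split; first exact: mE.
  by rewrite integral_fin_num_abs.
have iYZ := integrableZl measurableT r^-1 (integrableB measurableT iY iZ).
have : \int[m]_x (W x)%:E < +oo.
  apply: le_lt_trans (integrable_lty measurableT iYZ).
  apply: ae_le_integral => //; [exact: mE|exact: (measurable_int m iYZ)|].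
  apply: filterS YZW => x YZWx _ /=.
  rewrite -EFinB -EFinM lee_fin mulrC ler_ndivlMr// mulrC.
  by rewrite lerBlDl.
by rewrite Woo.
Qed.

Lemma le_integral_affine_ereal Y Z W (K : T -> R) (s : \bar R) :
  measurable_fun setT Y ->
  m.-integrable setT (EFin \o Z) -> measurable_fun setT W ->
  (forall x, (0 <= W x)%R) ->
  {ae m, forall x, (Y x = Z x + K x * W x)%R} ->
  {ae m, forall x, (K x)%:E <= s} -> -oo < s ->
  \int[m]_x (Y x)%:E <= \int[m]_x (Z x)%:E + s * \int[m]_x (W x)%:E.
Proof.
move=> mY iZ mW W0 YE Ks.
case: s Ks => [r Kr _|_ _|//].
  apply: le_integral_affine => //.
  apply: filterS2 YE Kr => x -> Kr.
  by rewrite lerD2l ler_wpM2r.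
have W0' : 0 <= \int[m]_x (W x)%:E.
  by rewrite integral_ge0// => x _; rewrite lee_fin.
have mW' : measurable_fun setT (EFin \o W) by exact/measurable_EFinP.
(* Here [s] is +oo, so the bound is +oo unless [W] has integral 0. *)
have [intW0|intW0] := eqVneq (\int[m]_x (W x)%:E) 0; last first.
  rewrite gt0_mulye ?lt0e ?intW0// addey ?leey//.
  by have := integrable_fin_num measurableT iZ; rewrite fin_numE => /andP[].
have W_ae0 : ae_eq m setT (EFin \o W) (cst 0).
  apply/(ae_eq_integral_abs m measurableT mW').
  rewrite -[RHS]intW0; apply: eq_integral => x _.
  by rewrite /= ger0_norm.
(* As [W] vanishes almost everywhere, [Y] equals [Z] almost everywhere; rewriting [s * 0] as
   [0 * \int W] gives the real-coefficient lemma with [r = 0]. *)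
rewrite intW0 mule0 -(mul0e (\int[m]_x (W x)%:E)).
apply: le_integral_affine => //.
apply: filterS2 YE W_ae0 => x -> /(_ Logic.I) [->].
by rewrite !mulr0.
Qed.

End integral.

Section open_itv.
Context (R : realType).
Implicit Types (a b : \bar R) (phi : R -> R).

(** Endpoints may be infinite, so the interval is taken as the preimage under [EFin] of the
    intersection of two open rays. *)
Lemma open_open_itv a b : open (open_itv a b).
Proof.
have := openI (@open_ereal_gt_ereal R a) (@open_ereal_lt_ereal R b).
by move/(@open_comp _ _ EFin); apply => x _ A.
Qed.

Lemma measurable_restrict_open_itv a b phi :
  (forall x, open_itv a b x -> derivable phi x 1) ->
  measurable_fun setT (phi \_ (open_itv a b)).
Proof.
move=> dphi; have oD := open_open_itv a b.
apply/(measurable_restrictT phi (open_measurable oD)).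
apply: open_continuous_measurable_fun => // x /set_mem Dx.
exact/differentiable_continuous/derivable1_diffP/dphi.
Qed.

(** Off [nu], [h] is this identity solved for the coefficient of the square; at [nu] the linear and
    quadratic terms vanish. *)
Lemma taylor_h phi x nu :
  phi x = phi nu + phi^`()%classic nu * (x - nu) + h phi x nu * (x - nu) ^+ 2.
Proof.
rewrite /h; case: eqP => [->|/eqP xnu]; first by rewrite subrr; ring.
by field; rewrite subr_eq0.
Qed.

End open_itv.

Section expectation.
Context d (T : measurableType d) (R : realType) (P : probability T R).
Implicit Types (Y : T -> R) (D : set R) (H : R -> R).
Local Open Scope ereal_scope.

Lemma probability1_ae (A : set T) : measurable A -> P A = 1 ->
  {ae P, forall t, A t}.
Proof.
move=> mA PA; exists (~` A); split => //; first exact: measurableC.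
by rewrite probability_setC// PA subee.
Qed.

Lemma variance_integralE Y :
  'V_P[Y] = \int[P]_t (((Y t - fine 'E_P[Y]) ^+ 2)%R)%:E.
Proof. by rewrite /variance covariance.unlock expectation.unlock. Qed.

(** With +oo - oo = -oo, negation could fail to commute with the integral only if both parts had
    infinite integral, which [expectation_exists] excludes. *)
Lemma expectationN_def Y : expectation_exists P Y -> 'E_P[\- Y] = - 'E_P[Y].
Proof.
move=> EY; move: EY; rewrite /expectation_exists expectation.unlock => EY.
rewrite -integralN//; move: EY.
have -> : (fun t => (Y t)%:E)^\+ = EFin \o Y^\+%R by exact: funerpos.
have -> : (fun t => (Y t)%:E)^\- = EFin \o Y^\-%R by exact: funerneg.
have ge0 (f : T -> R) : (forall t, 0 <= f t)%R -> 0 <= \int[P]_t (f t)%:E.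
  by move=> f0; apply: integral_ge0 => t _; rewrite lee_fin.
have := ge0 _ (funrpos_ge0 Y); have := ge0 _ (funrneg_ge0 Y).
rewrite /= /adde_def; case: (\int[P]_t _) => [q||]//.
all: by case: (\int[P]_t _) => [p||]//= _ _ [].
Qed.

(** A general [H] serves both [phi] with [h] and [- phi] with [- h]. The affine part integrates to
    [c] because [X - mu] has mean 0. *)
Lemma expectation_le_quadratic (X : {RV P >-> R}) D Y H (c k : R) :
  P.-integrable setT (EFin \o X) -> measurable_fun setT Y ->
  {ae P, forall t, D (X t)} ->
  (let mu := fine 'E_P[X] in {ae P, forall t, Y t =
    c + k * (X t - mu) + H (X t) * (X t - mu) ^+ 2}%R) ->
  'E_P[Y] <= c%:E + ereal_sup [set (H x)%:E | x in D] * 'V_P[X].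
Proof.
move=> iX mY XD /= YE; set mu := fine 'E_P[X].
pose Z : T -> R := (fun t => c + k * (X t - mu))%R.
have iX1 : P.-integrable setT (EFin \o (fun t => X t - mu)%R).
  have imu := finite_measure_integrable_cst P mu measurableT.
  exact: (integrableB measurableT iX imu).
have ikX := integrableZl measurableT k iX1.
have ic : P.-integrable setT (EFin \o cst c).
  exact: finite_measure_integrable_cst.
have iZ : P.-integrable setT (EFin \o Z) by exact: (integrableD measurableT ic ikX).
have intX1 : \int[P]_t (X t - mu)%:E = 0.
  have E : (fine 'E_P[X])%:E = \int[P]_t (X t)%:E.
    by rewrite unlock fineK// integrable_fin_num.
  under eq_integral do rewrite EFinB.
  rewrite integralB_EFin//; last exact: finite_measure_integrable_cst.
  rewrite -E /= integral_cst//= probability_setT mule1 subee//.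
have intZ : \int[P]_t (Z t)%:E = c%:E.
  under eq_integral do rewrite EFinD EFinM.
  rewrite integralD//= integralZl// intX1 mule0 adde0.
  by rewrite integral_cst//= probability_setT mule1.
(* An almost sure event is nonempty, so some [t] has [X t] in [D]; the value of [H] there keeps the
   supremum above -oo. *)
have P_proper : ProperFilter (almost_everywhere P).
  apply: ae_properfilter_algebraOfSetsType.
  by rewrite [ltRHS]probability_setT.
have [t Dt] := filter_ex XD.
rewrite variance_integralE -/mu expectation.unlock -intZ.
apply: (@le_integral_affine_ereal _ _ _ _ _ _ _ (H \o X)) => //.
- have mX : measurable_fun setT X by exact: measurable_funP.
  by apply: measurable_funX; exact: measurable_funB.
- by move=> ?; exact: sqr_ge0.
- by apply: filterS XD => u Du; apply: ereal_sup_ubound; exists (X u).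
- apply: (@lt_le_trans _ _ (H (X t))%:E); first exact: ltNyr.
  by apply: ereal_sup_ubound; exists (X t).
Qed.

End expectation.

Theorem theorem1 (R : realType) (d : measure_display) (T : measurableType d)
    (P : probability T R) (a b : \bar R) (X : {RV P >-> R}) (phi : R -> R)
    (lt_ab : (a < b)%E)
    (X_mean : P.-integrable [set: T] (EFin \o X))
    (X_ab : P (X @^-1` open_itv a b) = 1%E)
    (phi_diff : twice_derivable_on (open_itv a b) phi)
    (phiX_mean : expectation_exists P (comp_on (open_itv a b) phi X)) :
  let mu := fine 'E_P[X] in
  let gap := ('E_P[comp_on (open_itv a b) phi X] - (phi mu)%:E)%E in
  let hs := [set (h phi x mu)%:E | x in open_itv a b] in
  (ereal_inf hs * 'V_P[X] <= gap)%E /\ (gap <= ereal_sup hs * 'V_P[X])%E.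
Proof.
move=> mu gap hs; set D := open_itv a b in hs *; pose Y := comp_on D phi X.
have mX : measurable_fun setT X by exact: measurable_funP.
have mY : measurable_fun setT Y.
  apply: measurableT_comp => //; apply: measurable_restrict_open_itv.
  by move=> x /phi_diff[].
have XD : {ae P, forall t, D (X t)}.
  apply: probability1_ae X_ab; rewrite -[X in measurable X]setTI.
  exact: (mX _ _ (open_measurable (@open_open_itv R a b))).
have YE : {ae P, forall t, Y t = phi mu + phi^`()%classic mu * (X t - mu) +
    h phi (X t) mu * (X t - mu) ^+ 2}.
  apply: filterS XD => t Dt.
  by rewrite /Y /comp_on /= patchE mem_set// -taylor_h.
split; last first.
  rewrite /gap leeBlDl//.
  exact: (@expectation_le_quadratic _ _ _ _ _ _ _ (h phi ^~ mu)
    _ (phi^`()%classic mu)).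
(* For the lower bound, the value, the slope and [h] all change sign; the supremum of [- h] is then
   turned into minus the infimum of [h]. *)
have : ('E_P[\- Y] <= (- phi mu)%:E +
    ereal_sup [set (- h phi x mu)%:E | x in D] * 'V_P[X])%E.
  apply: (@expectation_le_quadratic _ _ _ _ _ _ _ (fun x => - h phi x mu)
    _ (- phi^`()%classic mu)) => //.
    exact: measurable_funN.
  by apply: filterS YE => t /= ->; rewrite -/mu; ring.
rewrite (@expectationN_def _ _ _ _ _ phiX_mean).
have -> : [set (- h phi x mu)%:E | x in D] = -%E @` hs.
  by rewrite image_comp.
rewrite ereal_supN EFinN mulNe -oppeD// leeN2.
by rewrite /gap leeBrDl.
Qed.
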